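(* Let $R$ be a unitary ring with involution $*$, let $a\in R$, and let $m,n$ be integers with $0\leq m<n$. If $a$ has a unique $m$-weak group inverse $a^{(\mathrm{W}_m)}$, then the following conditions are equivalent: (1) $a^{(\mathrm{W}_m)}a=aa^{(\mathrm{W}_m)}$; (2) $(a^{n})^{(\mathrm{W})}=(a^{(\mathrm{W}_m)})^{n}$; (3) $a^{(\mathrm{W}_m)}=a^{(\mathrm{W}_n)}$; (4) $a^{(\mathrm{W}_m)}=a^{D}$.
   Context: $R$ is an associative ring with identity $1$ equipped with an involution, i.e. a map $a\mapsto a^{*}$ with $(a+b)^{*}=a^{*}+b^{*}$, $(ab)^{*}=b^{*}a^{*}$, $(a^{*})^{*}=a$ for all $a,b\in R$. $\mathbb{N}$ is the set of nonnegative integers, $\mathbb{N}^{+}$ the set of positive integers, and $a^{0}=1$ for every $a\in R$. Drazin inverse: $a\in R$ is Drazin invertible if there exist $x\in R$ and $k\in\mathbb{N}^{+}$ with $xa^{k+1}=a^{k}$, $xax=x$, $xa=ax$; such $x$ is unique and denoted $a^{D}$. (Every $m$-weak group invertible element is Drazin invertible.) $m$-weak group inverse: for $a\in R$ and $m\in\mathbb{N}$, an element $x\in R$ is called an $m$-weak group inverse of $a$ if there exists $k\in\mathbb{N}^{+}$ such that $xa^{k+1}=a^{k}$, $ax^{2}=x$, and $(a^{k})^{*}a^{m+1}x=(a^{k})^{*}a^{m}$. When it is unique it is denoted $a^{(\mathrm{W}_m)}$. The weak group inverse is the $1$-weak group inverse; when it is unique it is denoted $a^{(\mathrm{W})}$.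 Under the hypothesis of the claim, $a$ also has a unique $n$-weak group inverse and $a^{n}$ has a unique weak group inverse, so all the notation in (1)-(4) is meaningful. *)

(* Defs.v *)
From mathcomp Require Export all_boot all_order all_algebra.

Set Implicit Arguments.
Unset Strict Implicit.
Unset Printing Implicit Defensive.

Import GRing.Theory.
Local Open Scope ring_scope.

(* Rings are pzRingType, so the zero ring is not excluded. *)

Definition ring_involution (R : pzRingType) (star : R -> R) : Prop :=
  [/\ forall a b : R, star (a + b) = star a + star b,
      forall a b : R, star (a * b) = star b * star a
    & forall a : R, star (star a) = a].

Definition drazin_inverse (R : pzRingType) (a x : R) : Prop :=
  exists2 k : nat, (0 < k)%N &
    [/\ x * a ^+ k.+1 = a ^+ k, x * a * x = x & x * a = a * x].

Definition mweak_group_inverse (R : pzRingType) (star : R -> R) (m : nat)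
    (a x : R) : Prop :=
  exists2 k : nat, (0 < k)%N &
    [/\ x * a ^+ k.+1 = a ^+ k, a * x ^+ 2 = x
      & star (a ^+ k) * a ^+ m.+1 * x = star (a ^+ k) * a ^+ m].

Definition weak_group_inverse (R : pzRingType) (star : R -> R) (a x : R) :
    Prop :=
  mweak_group_inverse star 1 a x.

(* The notations a^(W_m), a^(W) and a^D denote an element only when it is      *)
(* unique; "x = a^(W_m)" is the graph of this partial function, that is: x is  *)
(* an m-weak group inverse of a and there is no other one.                     *)

Definition eq_mWGI (R : pzRingType) (star : R -> R) (m : nat) (a x : R) :
    Prop :=
  unique (mweak_group_inverse star m a) x.

Definition eq_WGI (R : pzRingType) (star : R -> R) (a x : R) : Prop :=
  unique (weak_group_inverse star a) x.

Definition eq_Drazin (R : pzRingType) (a x : R) : Prop :=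
  unique (drazin_inverse a) x.

(* Main.v *)
Require Import Defs.
From mathcomp Require Import all_boot all_order all_algebra.

Set Implicit Arguments.
Unset Strict Implicit.
Unset Printing Implicit Defensive.

Import GRing.Theory.
Local Open Scope ring_scope.

(** Uniqueness is what makes the theorem work, and it is used in the following
    infinitesimal form.  Let x be an m-weak group inverse of a, with exponent k.
    If u lies in a^k R, u a^k = 0 and (a^k)^* a^(m+1) u = 0, then x + u is again
    an m-weak group inverse of a, because u x = u u = 0 and a x u = u; so u = 0
    when x is the only one ([perturb_mWGI]).  Conversely the difference of two
    p-weak group inverses is such a u, with p in place of m.  Since a is
    cancellable on the left on a^k R, the condition on u depends neither on m
    nor on the exponent, nor does it change when a is replaced by a positive
    power ([rigidity]).  Hence a unique m-weak group inverse of a forces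
    uniqueness of the n-weak group inverse of a and of the weak group inverse
    of a^n ([mWGI_exp_inj]), and only the defining equations matter.

    If x commutes with a, the equation (a^k)^* a^m (a x) = (a^k)^* a^m
    propagates to all powers of a x, and to all exponents above m, which gives
    the weak group inverse of a^n.  If x^n is a weak group inverse of a^n, the
    identity a^(2n) x^n = a^(n+1) x turns its last equation into the one of an
    n-weak group inverse of a.  If x is both an m-weak and an n-weak group
    inverse, then u = x a^(n-m) - a^(n-m) x is killed by rigidity, so x commutes
    with a^(n-m), hence with a ([commute_of_commute_exp]); an m-weak group
    inverse that commutes with a is the Drazin inverse. *)

(** * Inverting an element on the range of its powers *)

(** The two equations shared by m-weak group inverses and Drazin inverses. *)
Definition power_inverse (R : pzRingType) (k : nat) (a x : R) : Prop :=
  x * a ^+ k.+1 = a ^+ k /\ a * x ^+ 2 = x.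

Section PowerInverse.

Variables (R : pzRingType) (a : R).
Implicit Types (x y z : R) (j k l : nat).

Lemma expr_mul_exprS x j : a * x ^+ 2 = x -> a ^+ j * x ^+ j.+1 = x.
Proof.
move=> ax2; elim: j => [|j IHj]; first by rewrite mul1r.
by rewrite exprSr (exprD x 2 j) -mulrA (mulrA a) ax2 -exprS.
Qed.

Lemma power_inverse_leq k l x :
  (k <= l)%N -> power_inverse k a x -> power_inverse l a x.
Proof.
move=> /subnKC <- [xa ax2]; split=> //.
by rewrite -addSn !exprD mulrA xa.
Qed.

Lemma power_inverse_mulVX k j x :
  power_inverse k a x -> x ^+ j * a ^+ (j + k) = a ^+ k.
Proof.
move=> px; elim: j => [|j IHj]; first by rewrite mul1r.
have [xa _] := power_inverse_leq (leq_addl j k) px.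
by rewrite exprSr -mulrA addSn xa.
Qed.

Lemma power_inverse_mulXV k x : power_inverse k a x -> a * x * a ^+ k = a ^+ k.
Proof. by case=> xa ax2; rewrite -{1}xa mulrA -(mulrA a) -expr2 ax2. Qed.

(** Both y and z invert a on the range of a^k, and a^k factors on the left
    through a^(k+1). *)
Lemma power_inverse_mulX k y z :
  power_inverse k a y -> power_inverse k a z -> y * a ^+ k = z * a ^+ k.
Proof.
move=> [ya _] pz; have az2 := pz.2.
have akE : a ^+ k = a ^+ k.+1 * z ^+ k.+1 * a ^+ k.
  by rewrite exprS -(mulrA a) (expr_mul_exprS _ az2) power_inverse_mulXV.
by rewrite {1}akE !mulrA ya (expr_mul_exprS _ az2).
Qed.

Lemma power_inverse_outer k x : power_inverse k a x -> x * a * x = x.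
Proof.
move=> [xa ax2]; rewrite -{2}(expr_mul_exprS k ax2) mulrA -(mulrA x) -exprS xa.
exact: expr_mul_exprS.
Qed.

(** Commuting with a^p, x commutes with a^K for some K >= k, so that
    x = a^K x^(K+1) = x^(K+1) a^K; both a x and x a then collapse to x^K a^K. *)
Lemma commute_of_commute_exp k p x :
  (0 < k)%N -> (0 < p)%N -> power_inverse k a x ->
  x * a ^+ p = a ^+ p * x -> x * a = a * x.
Proof.
move=> k_gt0 p_gt0 px xap.
have le_k : (k <= p * k)%N by rewrite leq_pmull.
have [xa ax2] := power_inverse_leq le_k px.
have K_gt0 := leq_trans k_gt0 le_k.
have comm : GRing.comm (x ^+ (p * k).+1) (a ^+ (p * k)).
  rewrite exprM; apply: commrX; apply/commr_sym; apply: commrX.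
  exact/commr_sym.
have xE : x = x ^+ (p * k).+1 * a ^+ (p * k).
  by rewrite comm expr_mul_exprS.
rewrite {1}xE {2}xE -(mulrA _ _ a) -exprSr exprSr -mulrA xa.
case: (p * k)%N K_gt0 => // K _.
by rewrite -exprSr (exprD x 2 K) mulrA mulrA ax2 -exprS.
Qed.

(** Both inverses equal y a z. *)
Lemma drazin_inverse_inj y z :
  drazin_inverse a y -> drazin_inverse a z -> y = z.
Proof.
have powP k w : [/\ w * a ^+ k.+1 = a ^+ k, w * a * w = w & w * a = a * w] ->
    power_inverse k a w.
  by case=> wa waw comm_w; split=> //; rewrite expr2 mulrA -comm_w.
move=> [k1 _ dy] [k2 _ dz].
have py := power_inverse_leq (leq_maxl k1 k2) (powP _ _ dy).
have pz := power_inverse_leq (leq_maxr k1 k2) (powP _ _ dz).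
set k := maxn k1 k2 in py pz; have [ya ay2] := py; have [za az2] := pz.
have [[_ _ comm_y] [_ _ comm_z]] := (dy, dz).
have -> : z = y * a * z.
  by rewrite -{2}(expr_mul_exprS k az2) mulrA -(mulrA y) -exprS ya expr_mul_exprS.
have yE : y = y ^+ k.+1 * a ^+ k.
  rewrite -{1}(expr_mul_exprS k ay2); apply/commr_sym/commrX/commr_sym/commrX.
  exact/commr_sym.
have zaE : a ^+ k.+1 * z = a ^+ k.
  by rewrite -za; apply/commr_sym/commrX.
by rewrite [in RHS]yE -(mulrA _ _ a) -exprSr -mulrA zaE.
Qed.

End PowerInverse.

(** * Rigidity of a unique m-weak group inverse *)

Section Rigidity.

Variables (R : pzRingType) (star : R -> R).
Hypothesis star_inv : ring_involution star.
Implicit Types (a b x y z : R) (k m n p : nat).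

(** The exponent k is exposed so that several inverses can be brought to a
    common one. *)
Definition mWGI_at m k a x : Prop :=
  power_inverse k a x /\
  star (a ^+ k) * a ^+ m.+1 * x = star (a ^+ k) * a ^+ m.

Lemma mWGI_atP m a x :
  mweak_group_inverse star m a x <-> exists2 k, (0 < k)%N & mWGI_at m k a x.
Proof.
split=> -[k k_gt0]; first by case=> xa ax2 sax; exists k.
by case=> -[xa ax2] sax; exists k.
Qed.

Lemma star_exprD a k l : star (a ^+ (k + l)) = star (a ^+ l) * star (a ^+ k).
Proof. by case: star_inv => _ starM _; rewrite exprD starM. Qed.

Lemma mWGI_at_leq m k l a x :
  (k <= l)%N -> mWGI_at m k a x -> mWGI_at m l a x.
Proof.
move=> le_kl [px sax]; split; first exact: power_inverse_leq px.
by rewrite -(subnKC le_kl) star_exprD -!mulrA !(mulrA (star (a ^+ k))) sax.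
Qed.

(** With u = a^k s, the hypothesis u a^k = 0 kills u x and u u, whose right
    factors lie in a^k R, while a x fixes u; thus a (x + u)^2 = x + u. *)
Lemma perturb_mWGI m k a x s :
    (0 < k)%N -> mWGI_at m k a x ->
    a ^+ k * s * a ^+ k = 0 -> star (a ^+ k) * a ^+ m.+1 * (a ^+ k * s) = 0 ->
  mweak_group_inverse star m a (x + a ^+ k * s).
Proof.
move=> k_gt0 [px sax]; have [xa ax2] := px.
set u := a ^+ k * s => ua su; exists k => //; split.
- by rewrite mulrDl xa exprSr mulrA ua mul0r addr0.
- have ux : u * x = 0 by rewrite -(expr_mul_exprS k ax2) mulrA ua mul0r.
  have uu : u * u = 0 by rewrite {2}/u mulrA ua mul0r.
  have axu : a * x * u = u by rewrite /u mulrA power_inverse_mulXV.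
  rewrite expr2 mulrDr !mulrDl ux uu addr0 addr0 mulrDr -expr2 ax2.
  by rewrite mulrA axu.
- by rewrite mulrDr su addr0.
Qed.

(** For N = m + 1 this is uniqueness applied to the perturbed inverse; a larger
    N is allowed because x undoes multiplication by a on a^k R. *)
Lemma rigidity m N k a x s :
    (0 < k)%N -> (m < N)%N -> unique (mweak_group_inverse star m a) x ->
    mWGI_at m k a x ->
    a ^+ k * s * a ^+ k = 0 -> star (a ^+ k) * a ^+ N * (a ^+ k * s) = 0 ->
  a ^+ k * s = 0.
Proof.
move=> k_gt0 lt_mN [_ x_uniq] wx sa ssa; have [px _] := wx.
have NE : N = (m.+1 + (N - m.+1))%N by rewrite subnKC.
set j := (N - m.+1)%N in NE.
(* The perturbation a^j a^k s moves the surplus exponent j = N - (m+1) into u. *)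
have exE : a ^+ k * (a ^+ j * s) = a ^+ j * (a ^+ k * s).
  by rewrite !mulrA -!exprD addnC.
have u0 : a ^+ k * (a ^+ j * s) = 0.
  apply: (addrI x); rewrite addr0; apply/esym/x_uniq.
  apply: (perturb_mWGI k_gt0 wx); first by rewrite exE -mulrA sa mulr0.
  by rewrite exE mulrA -(mulrA (star _)) -exprD -NE.
by rewrite -(power_inverse_mulVX j px) exprD -!mulrA -exE u0 mulr0.
Qed.

Lemma mWGI_at_subr m k a y z :
    mWGI_at m k a y -> mWGI_at m k a z ->
  exists2 s, y - z = a ^+ k * s &
    a ^+ k * s * a ^+ k = 0 /\ star (a ^+ k) * a ^+ m.+1 * (a ^+ k * s) = 0.
Proof.
move=> [py say] [pz saz]; have [[_ ay2] [_ az2]] := (py, pz).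
exists (y ^+ k.+1 - z ^+ k.+1); rewrite mulrBr !expr_mul_exprS //.
by rewrite mulrBl mulrBr (power_inverse_mulX py pz) say saz !subrr.
Qed.

(** The difference y - z satisfies the hypotheses of rigidity for a, because the
    equations for a^n at the exponent k are equations for a at n k. Taking p = 1
    gives uniqueness of the weak group inverse of a^n, and n = 1
    that of the p-weak group inverse of a for every p >= m. *)
Lemma mWGI_exp_inj m n p a x y z :
    (0 < n)%N -> (m < n * p.+1)%N -> unique (mweak_group_inverse star m a) x ->
    mweak_group_inverse star p (a ^+ n) y ->
    mweak_group_inverse star p (a ^+ n) z ->
  y = z.
Proof.
move=> n_gt0 lt_m x_uniq /mWGI_atP[k1 _ wy] /mWGI_atP[k2 _ wz].
have /mWGI_atP[k3 k3_gt0 wx] := x_uniq.1.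
pose k := (k1 + k2 + k3)%N.
have {}wy : mWGI_at p k (a ^+ n) y.
  by apply: mWGI_at_leq wy; rewrite /k -addnA leq_addr.
have {}wz : mWGI_at p k (a ^+ n) z.
  by apply: mWGI_at_leq wz; rewrite /k addnAC leq_addl.
have le_k3 : (k3 <= n * k)%N.
  by apply: leq_trans (leq_pmull _ n_gt0); rewrite leq_addl.
have nk_gt0 := leq_trans k3_gt0 le_k3.
have [s dE] := mWGI_at_subr wy wz; rewrite -!exprM in dE * => -[ds sds].
apply/eqP; rewrite -subr_eq0 dE; apply/eqP.
exact: (rigidity nk_gt0 lt_m x_uniq (mWGI_at_leq le_k3 wx) ds sds).
Qed.

(** * Commutation and the defining equations *)

(** Since x commutes with a, a^(2n) x^n = a^m (a x)^n a^(n-m), and a x is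
    absorbed by (a^k)^* a^m. *)
Lemma commute_WGI_exp m n a x :
    (m < n)%N -> mweak_group_inverse star m a x -> x * a = a * x ->
  weak_group_inverse star (a ^+ n) (x ^+ n).
Proof.
move=> lt_mn /mWGI_atP[k k_gt0 wx] comm_x.
have n_gt0 : (0 < n)%N := leq_ltn_trans (leq0n m) lt_mn.
have le_k : (k <= n * k)%N by rewrite leq_pmull.
have [px sax] := mWGI_at_leq le_k wx; have [xa ax2] := px.
have commX i j : x ^+ i * a ^+ j = a ^+ j * x ^+ i.
  by apply: commrX; apply/commr_sym; apply: commrX; apply/commr_sym.
apply/mWGI_atP; exists k => //; split; first split.
- by rewrite -!exprM mulnS power_inverse_mulVX.
- rewrite -exprM mulnC exprM -exprMn_comm ?ax2 //.
  by apply: commrX; apply/esym.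
have absorb j : star (a ^+ (n * k)) * a ^+ m * (a * x) ^+ j
    = star (a ^+ (n * k)) * a ^+ m.
  elim: j => [|j IHj]; first by rewrite mulr1.
  by rewrite exprS mulrA (mulrA _ a x) -(mulrA _ _ a) -exprSr sax.
have comm_ax : GRing.comm (a ^+ (n - m)) ((a * x) ^+ n).
  apply: commrX; apply/commr_sym; apply: commrX.
  by rewrite /GRing.comm -mulrA comm_x.
rewrite -!exprM muln2 -addnn muln1 exprD -2!mulrA.
rewrite -exprMn_comm; last exact: esym.
have anE : a ^+ n = a ^+ m * a ^+ (n - m) by rewrite -exprD subnKC // ltnW.
by rewrite anE -(mulrA (a ^+ m)) comm_ax !mulrA absorb.
Qed.

(** The bridge is a^(2n) x^n = a^(n+1) (a^(n-1) x^n) = a^(n+1) x. *)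
Lemma WGI_exp_mWGI m n a x :
    (0 < n)%N -> mweak_group_inverse star m a x ->
    weak_group_inverse star (a ^+ n) (x ^+ n) ->
  mweak_group_inverse star n a x.
Proof.
move=> n_gt0 /mWGI_atP[k1 _ [px _]] /mWGI_atP[k2 k2_gt0 [_ sx]].
have nk2_gt0 : (0 < n * k2)%N by rewrite muln_gt0 n_gt0.
apply/mWGI_atP; exists (n * k2 + k1)%N; first by rewrite addn_gt0 nk2_gt0.
split; first by apply: power_inverse_leq px; rewrite leq_addl.
have bridge : a ^+ (n * 2) * x ^+ n = a ^+ n.+1 * x.
  case: n n_gt0 {sx nk2_gt0} => // n _.
  rewrite -{2}(expr_mul_exprS n px.2) mulrA -exprD; congr (a ^+ _ * _).
  by rewrite muln2 -addnn addnS addSn.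
move: sx; rewrite -!exprM muln1 -mulrA bridge => sx.
by rewrite star_exprD -!mulrA sx.
Qed.

(** With p = n - m and u = x a^p - a^p x, the m-equation multiplied on the right
    by a^p and the n-equation give (a^k)^* a^(m+1) u = 0; rigidity makes u
    vanish, so x commutes with a^p. *)
Lemma mWGI_mWGI_commute m n a x :
    (m < n)%N -> unique (mweak_group_inverse star m a) x ->
    mweak_group_inverse star n a x ->
  x * a = a * x.
Proof.
move=> lt_mn x_uniq /mWGI_atP[k2 _ wnx]; have /mWGI_atP[k1 k1_gt0 wx] := x_uniq.1.
pose k := (k1 + k2)%N.
have {}wx : mWGI_at m k a x.
  by apply: mWGI_at_leq wx; rewrite leq_addr.
have {}wnx : mWGI_at n k a x.
  by apply: mWGI_at_leq wnx; rewrite leq_addl.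
have k_gt0 : (0 < k)%N by rewrite addn_gt0 k1_gt0.
have [px sax] := wx; have [_ snx] := wnx; have [xa ax2] := px.
pose p := (n - m)%N; have p_gt0 : (0 < p)%N by rewrite subn_gt0.
apply: (@commute_of_commute_exp _ _ k p) => //.
apply/eqP; rewrite -subr_eq0; apply/eqP.
pose s := x ^+ k.+1 * a ^+ p - a ^+ p * x ^+ k.+1.
have uE : x * a ^+ p - a ^+ p * x = a ^+ k * s.
  rewrite mulrBr !mulrA (expr_mul_exprS _ ax2) -exprD addnC exprD -mulrA.
  by rewrite (expr_mul_exprS _ ax2).
rewrite uE; apply: (@rigidity m m.+1 k a x s) => //; rewrite -uE.
  (* Both a^p x a^k and x a^p a^k are a^(p-1) a^k. *)
  rewrite mulrBl; apply/eqP; rewrite subr_eq0; apply/eqP.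
  case: (p) p_gt0 => // q _; rewrite -mulrA -exprD addSnnS addnC exprD mulrA xa.
  by rewrite exprSr -!mulrA (mulrA a) power_inverse_mulXV // -!exprD addnC.
rewrite mulrBr !mulrA sax -!(mulrA (star _)) -!exprD addSn subnKC ?(ltnW lt_mn) //.
by rewrite mulrA snx subrr.
Qed.

End Rigidity.

Theorem theorem4p13 (R : pzRingType) (star : R -> R)
    (star_inv : ring_involution star) (a : R) (m n : nat) (lt_mn : (m < n)%N)
    (x : R) (x_def : eq_mWGI star m a x) :
  [<-> x * a = a * x;
       eq_WGI star (a ^+ n) (x ^+ n);
       eq_mWGI star n a x;
       eq_Drazin a x].
Proof.
have n_gt0 : (0 < n)%N := leq_ltn_trans (leq0n m) lt_mn.
have wx := x_def.1.
tfae=> [comm_x | [wxn _] | [wnx _] | [[k _ []]]] //.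
- have wxn := commute_WGI_exp star_inv lt_mn wx comm_x.
  have lt_m : (m < n * 2)%N by rewrite (leq_trans lt_mn) // leq_pmulr.
  by split=> // y; apply: (mWGI_exp_inj star_inv n_gt0 lt_m x_def wxn).
- have wnx := WGI_exp_mWGI star_inv n_gt0 wx wxn.
  split=> // y wny.
  by apply: (@mWGI_exp_inj _ _ star_inv m 1 n a x) => //;
    rewrite ?mul1n ?expr1 // ltnS ltnW.
- have comm_x := mWGI_mWGI_commute star_inv lt_mn x_def wnx.
  have /mWGI_atP[k k_gt0 [px _]] := wx.
  have dx : drazin_inverse a x.
    by exists k => //; split; [case: px | apply: power_inverse_outer px |].
  by split=> // y; apply: drazin_inverse_inj.
Qed.
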